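(* For all $l,\nu\in\mathbb{R}$, the function $$h^{(l,\nu)}(s,t;x,y)=\exp\left(-\frac{2}{t-s}(x+\nu s-l)(y+\nu t-l)\right),\qquad 0<s<t,\ x,y\in\mathbb{R},$$ is past-future harmonic (PFH).
   Context: Let $(B_t)_{t\ge0}$ be a standard one-dimensional Brownian motion started at $0$ and, for $0<s<t<\infty$, let $\mathcal{F}_{s,t}=\sigma\{B_u,\ u\le s;\ B_v,\ v\ge t\}$ (note that $\mathcal{F}_{s,t}\supseteq\mathcal{F}_{s',t'}$ if $[s,t]\subset[s',t']$). A positive $(\mathcal{F}_{s,t})$-martingale is an $\mathbb{R}^+$-valued family $(M_{s,t})_{0<s<t}$, with $M_{s,t}$ being $\mathcal{F}_{s,t}$-measurable, such that $\mathbb{E}[M_{s,t}\mid\mathcal{F}_{s',t'}]=M_{s',t'}$ a.s. whenever $0<s'\le s<t\le t'<\infty$ (conditional expectation of nonnegative random variables). A function $h(s,t;x,y)\ge 0$, $0<s<t$, $x,y\in\mathbb{R}$, is past-future harmonic (PFH) if $h(s,t;B_s,B_t)$ is a positive $(\mathcal{F}_{s,t})$-martingale. *)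

(* Defs.v *)
From mathcomp Require Export all_boot all_order all_algebra.
From mathcomp Require Export all_classical all_reals all_analysis.
From mathcomp Require Export measurable_realfun.

Set Implicit Arguments.
Unset Strict Implicit.
Unset Printing Implicit Defensive.

Export Order.TTheory GRing.Theory Num.Theory.
Export numFieldNormedType.Exports.

Local Open Scope classical_set_scope.
Local Open Scope ring_scope.

(* Since each A i may be taken to be setT, the product rule over the whole
   finite family gives the product rule over all its subfamilies. *)
Definition mutually_independent (d : measure_display) (T : measurableType d)
    (R : realType) (P : probability T R) (n : nat) (X : 'I_n -> T -> R) :=
  forall A : 'I_n -> set R, (forall i, measurable (A i)) ->
    P (\bigcap_(i in [set: 'I_n]) X i @^-1` A i)
      = (\prod_(i < n) P (X i @^-1` A i))%E.

(* Time is the half-line [0, +oo[: the values of B at negative times play no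
   role. normal_prob takes the standard deviation as its second parameter. *)
Record standard_brownian_motion (d : measure_display) (T : measurableType d)
    (R : realType) (P : probability T R) (B : R -> {RV P >-> R}) : Prop := {
  brownian_start : {ae P, forall w, B 0 w = 0} ;
  brownian_indep : forall (n : nat) (t : nat -> R),
    0 <= t 0%N -> (forall i, t i < t i.+1) ->
    mutually_independent P (fun (i : 'I_n) w => B (t i.+1) w - B (t i) w) ;
  brownian_normal : forall s t : R, 0 <= s -> s < t ->
    forall A : set R, measurable A ->
      P ((fun w => B t w - B s w) @^-1` A)
        = normal_prob 0 (Num.sqrt (t - s)) A ;
  brownian_continuous :
    {ae P, forall w, {within `[0, +oo[, continuous (fun t : R => B t w)}} }.

Definition past_future (d : measure_display) (T : measurableType d)
    (R : realType) (P : probability T R) (B : R -> {RV P >-> R}) (s t : R)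
    : set_system T :=
  <<s \bigcup_(u in [set u : R | 0 <= u <= s \/ t <= u])
        preimage_set_system setT (B u) measurable >>.

Definition sub_measurable (T : Type) (d' : measure_display)
    (T' : measurableType d') (G : set_system T) (X : T -> T') :=
  forall A : set T', measurable A -> G (X @^-1` A).

(* Y is a version of E[X | G], for a nonnegative random variable X and a
   sub-sigma-algebra G; no integrability of X is required. *)
Definition is_cond_expectation (d : measure_display) (T : measurableType d)
    (R : realType) (P : probability T R) (G : set_system T)
    (X Y : T -> \bar R) :=
  [/\ sub_measurable G Y,
      forall w, (0 <= Y w)%E
    & forall A, G A -> (\int[P]_(w in A) Y w = \int[P]_(w in A) X w)%E].

Record positive_past_future_martingale (d : measure_display)
    (T : measurableType d) (R : realType) (P : probability T R)
    (B : R -> {RV P >-> R}) (M : R -> R -> T -> R) : Prop := {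
  pfm_ge0 : forall s t : R, 0 < s -> s < t -> forall w, 0 <= M s t w ;
  pfm_measurable : forall s t : R, 0 < s -> s < t ->
    sub_measurable (past_future B s t) (M s t) ;
  pfm_cond_expectation : forall s' s t t' : R,
    0 < s' -> s' <= s -> s < t -> t <= t' ->
    is_cond_expectation P (past_future B s' t')
      (EFin \o M s t) (EFin \o M s' t') }.

Definition past_future_harmonic (d : measure_display) (T : measurableType d)
    (R : realType) (P : probability T R) (B : R -> {RV P >-> R})
    (h : R -> R -> R -> R -> R) : Prop :=
  (forall s t x y : R, 0 < s -> s < t -> 0 <= h s t x y) /\
  positive_past_future_martingale B (fun s t w => h s t (B s w) (B t w)).

Definition h_pfh (R : realType) (l nu s t x y : R) : R :=
  expR (- (2 / (t - s)) * (x + nu * s - l) * (y + nu * t - l)).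

(* Main.v *)
(* Write p(tau; x, y) for the Brownian transition density. The exponential in h
   turns p(t - s; x, y) into p(t - s; x, -y), up to the drift and the shift by
   l, so by Chapman-Kolmogorov E[h(s, t; B_s, B_t) | F_{s',t'}] is again a
   reflected transition density divided by p(t' - s'; x', y'). It suffices to
   move one end point at a time, F_{s',t} being larger than F_{s',t'}. Moving
   one end point of [p, r] to an interior q only involves the increments
   a = B_q - B_p and b = B_r - B_q, which are independent of each other and of
   the sigma-algebra generated by the B_u (u <= p) and the B_v - B_u
   (r <= u <= v). After freezing the latter, what remains is a Gaussian integral
   in a with a + b fixed, computed by completing the square. *)
Require Import Defs.
From HB Require Import structures.
From mathcomp Require Import zify ring.

Set Implicit Arguments.
Unset Strict Implicit.
Unset Printing Implicit Defensive.

Local Open Scope classical_set_scope.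
Local Open Scope ring_scope.

(** * Integration against normal laws and translation invariance *)

(** The change of variables is first done with the abstract Radon-Nikodym derivative; that
    derivative is almost everywhere [normal_pdf], since both have the same integral over every
    measurable set. *)
Lemma ge0_integral_normal_prob (R : realType) (m s : R) (f : R -> \bar R) :
  measurable_fun setT f -> (forall x, 0 <= f x)%E ->
  (\int[normal_prob m s]_x f x =
   \int[lebesgue_measure]_x (f x * (normal_pdf m s x)%:E))%E.
Proof.
move=> mf f0.
have dom := normal_prob_dominates m s.
rewrite -(Radon_Nikodym_SigmaFinite.change_of_variables dom)//=.
have mpdf : measurable_fun [set: R] (EFin \o normal_pdf m s).
  by apply/measurable_EFinP; exact: measurable_normal_pdf.
have iRN := Radon_Nikodym_SigmaFinite.f_integrable dom.
apply: ge0_ae_eq_integral => //=.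
- by apply: emeasurable_funM => //; exact: measurable_int iRN.
- exact: emeasurable_funM.
- by move=> x _; rewrite mule_ge0// Radon_Nikodym_SigmaFinite.f_ge0.
- by move=> x _; rewrite mule_ge0// lee_fin normal_pdf_ge0.
- apply: ae_eqe_mul2l => /=.
  apply: integral_ae_eq => //= E _ mE.
  by rewrite -Radon_Nikodym_SigmaFinite.f_integral.
Qed.

Lemma lebesgue_measure_shift (R : realType) (a : R) (A : set R) :
  measurable A ->
  pushforward lebesgue_measure
    ((fun x => x + a) : measurableTypeR R -> measurableTypeR R) A =
  lebesgue_measure A.
Proof.
have ms : measurable_fun [set: measurableTypeR R]
    (fun x : measurableTypeR R => x + a : measurableTypeR R).
  exact: measurable_funD.
move=> mA; apply/esym.
apply: lebesgue_measure_unique => //= _ [[b c]] _ <-.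
rewrite /pushforward.
rewrite (_ : _ @^-1` _ = `](b - a), (c - a)]%classic); last first.
  by apply/seteqP; split => x /=; rewrite !in_itv/= ltrBlDr lerBrDr.
rewrite !lebesgue_measure_itv/= !lte_fin ltrD2r.
by case: ifP => // _; rewrite -!EFinB; congr EFin; ring.
Qed.

Lemma ge0_integral_shift (R : realType) (a : R) (f : R -> \bar R) :
  measurable_fun setT f -> (forall x, 0 <= f x)%E ->
  (\int[lebesgue_measure]_x f (x + a)%R = \int[lebesgue_measure]_x f x)%E.
Proof.
move=> mf f0.
have ms : measurable_fun [set: measurableTypeR R]
    (fun x : measurableTypeR R => x + a : measurableTypeR R).
  exact: measurable_funD.
rewrite -[RHS](@eq_measure_integral _ _ _ _ _
  (pushforward lebesgue_measure
    ((fun x => x + a) : measurableTypeR R -> measurableTypeR R))); last first.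
  by move=> A mA _; exact: lebesgue_measure_shift.
by rewrite ge0_integral_pushforward.
Qed.

(** Here [x] is the first of two independent increments and [z] their sum. The last hypothesis says
    that for fixed [z] the full integrand is [c z] times a normal density in [x], which has total
    mass one, so integrating in [x] first leaves [c z]. *)
Lemma integral_normal_convolution (R : realType) (s1 s2 s : R) (m c : R -> R)
    (k : R -> R -> R) :
  measurable_fun setT (fun xz : R * R => k xz.1 xz.2) ->
  (forall x z, 0 <= k x z) -> (forall z, 0 <= c z) ->
  (forall x z, normal_pdf 0 s1 x * normal_pdf 0 s2 (z - x) * k x z =
               c z * normal_pdf (m z) s x) ->
  (\int[normal_prob 0 s1]_x \int[normal_prob 0 s2]_y (k x (x + y))%:E =
   \int[lebesgue_measure]_z (c z)%:E)%E.
Proof.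
move=> mk k0 c0 kc.
have mpdf a b : measurable_fun [set: R] (normal_pdf a b).
  exact: measurable_normal_pdf.
have mkx x : measurable_fun [set: R] (k x).
  exact: (measurableT_comp mk (pair1_measurable x)).
have mks : measurable_fun [set: R * R]
    (fun p : R * R => (k p.1 (p.1 + p.2))%:E).
  apply/measurable_EFinP.
  apply: (measurableT_comp (f := fun xz : R * R => k xz.1 xz.2)
    (g := fun p : R * R => (p.1, p.1 + p.2))) => //.
  by apply: measurable_fun_pair => //; apply: measurable_funD.
have mF : measurable_fun [set: R]
    (fun x => \int[normal_prob 0 s2]_y (k x (x + y)%R)%:E)%E.
  have := @measurable_fun_fubini_tonelli_F _ _ R (measurableTypeR R) R
    (normal_prob 0 s2) _ mks.
  by apply => p; rewrite lee_fin.
rewrite ge0_integral_normal_prob//; last first.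
  by move=> x; apply: integral_ge0 => y _; rewrite lee_fin.
pose G (p : R * R) :=
  (normal_pdf 0 s1 p.1 * normal_pdf 0 s2 (p.2 - p.1) * k p.1 p.2)%R.
have mG : measurable_fun setT (EFin \o G).
  apply/measurable_EFinP; apply: measurable_funM => //.
  apply: measurable_funM; first exact: measurableT_comp.
  by apply: measurableT_comp => //; exact: measurable_funB.
have G0 p : (0 <= (EFin \o G) p)%E.
  by rewrite lee_fin /G !mulr_ge0// normal_pdf_ge0.
transitivity
  (\int[lebesgue_measure]_x \int[lebesgue_measure]_z (EFin \o G) (x, z))%E.
  apply: eq_integral => x _.
  rewrite ge0_integral_normal_prob//; first last.
  - by move=> y; rewrite lee_fin.
  - apply/measurable_EFinP; apply: measurableT_comp => //.
    exact: measurable_funD.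
  (* The variable is changed from the second increment [y] to the sum [z = x + y]. *)
  rewrite -(@ge0_integral_shift _ (- x)); first last.
  - by move=> y; rewrite mule_ge0// lee_fin// normal_pdf_ge0.
  - apply: emeasurable_funM; apply/measurable_EFinP => //.
    by apply: measurableT_comp => //; exact: measurable_funD.
  rewrite -ge0_integralZr//; first last.
  - by rewrite lee_fin normal_pdf_ge0.
  - by move=> y _; rewrite mule_ge0// lee_fin// normal_pdf_ge0.
  - apply: emeasurable_funM; apply/measurable_EFinP => //.
      apply: measurableT_comp => //; apply: measurable_funD => //.
      exact: measurable_funD.
    apply: measurableT_comp => //; exact: measurable_funD.
  apply: eq_integral => z _ /=; rewrite /G/= -!EFinM; congr EFin.
  rewrite (_ : x + (z - x) = z); last by ring.
  by ring.
(* Tonelli puts the integral in [x] inside, where [kc] applies. *)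
rewrite (@fubini_tonelli _ _ (measurableTypeR R) (measurableTypeR R) R
  lebesgue_measure lebesgue_measure _ mG G0); apply: eq_integral => z _.
under eq_integral do rewrite /= /G/= kc EFinM.
rewrite ge0_integralZl//.
- by rewrite integral_normal_pdf mule1.
- by apply/measurable_EFinP; exact: mpdf.
- by move=> x _; rewrite lee_fin normal_pdf_ge0.
- by rewrite lee_fin.
Qed.

(** * Gaussian identities by completing the square *)

Lemma normal_pdf_sqrtE (R : realType) (m tau x : R) : 0 < tau ->
  normal_pdf m (Num.sqrt tau) x =
  (Num.sqrt (tau * pi *+ 2))^-1 * expR (- (x - m) ^+ 2 / (tau *+ 2)).
Proof.
move=> tau0; rewrite normal_pdfE; last by rewrite gt_eqF// sqrtr_gt0.
by rewrite /normal_peak /normal_fun sqr_sqrtr// ltW.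
Qed.

(** The normalizing constants always match, because [tau1 * tau2] is the product of [tau1 + tau2]
    and the Brownian bridge variance [tau1 * tau2 / (tau1 + tau2)]. Only an identity between the
    exponents is left to be checked in each use. *)
Lemma normal_pdf_complete_square (R : realType) (tau1 tau2 x z m e1 e2 : R) :
  0 < tau1 -> 0 < tau2 ->
  - x ^+ 2 / (tau1 *+ 2) - (z - x) ^+ 2 / (tau2 *+ 2) + e1 =
  - z ^+ 2 / ((tau1 + tau2) *+ 2) + e2
  - (x - m) ^+ 2 / ((tau1 * tau2 / (tau1 + tau2)) *+ 2) ->
  normal_pdf 0 (Num.sqrt tau1) x * normal_pdf 0 (Num.sqrt tau2) (z - x)
    * expR e1 =
  normal_pdf 0 (Num.sqrt (tau1 + tau2)) z * expR e2
    * normal_pdf m (Num.sqrt (tau1 * tau2 / (tau1 + tau2))) x.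
Proof.
move=> t1 t2 e12.
have t12 : 0 < tau1 + tau2 by rewrite addr_gt0.
have t3 : 0 < tau1 * tau2 / (tau1 + tau2) by rewrite divr_gt0// mulr_gt0.
have pi0 := @pi_gt0 R.
rewrite !normal_pdf_sqrtE// !subr0.
set a1 := Num.sqrt _; set a2 := Num.sqrt _.
set a := Num.sqrt _; set a3 := Num.sqrt _.
have pk : a1^-1 * a2^-1 = a^-1 * a3^-1.
  rewrite -!invfM; congr (_^-1).
  rewrite /a1 /a2 /a /a3 -!sqrtrM ?mulrn_wge0 ?mulr_ge0 ?ltW//.
  by congr Num.sqrt; field; rewrite gt_eqF.
set E1 := expR _; set E2 := expR _; set E := expR (- z ^+ 2 / _).
set E3 := expR (- (x - m) ^+ 2 / _).
have ee : E1 * E2 * expR e1 = E * expR e2 * E3.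
  rewrite /E1 /E2 /E /E3 -!expRD; congr expR.
  by move: e12; rewrite !mulNr => ->.
transitivity ((a1^-1 * a2^-1) * (E1 * E2 * expR e1)); first by ring.
by rewrite pk ee; ring.
Qed.

(** [X] and [Y] are the end positions after adding the drift and subtracting [l]. The mean is that
    of a bridge to the reflected end point: sending [Y] to [- Y] changes the total increment [z]
    into [z - 2 * Y]. *)
Lemma h_pfh_past_step (R : realType) (tau1 tau2 X x z nu : R) :
  0 < tau1 -> 0 < tau2 ->
  let Y := X + z + nu * (tau1 + tau2) in
  normal_pdf 0 (Num.sqrt tau1) x * normal_pdf 0 (Num.sqrt tau2) (z - x)
    * expR (- (2 / tau2) * (X + x + nu * tau1) * Y) =
  normal_pdf 0 (Num.sqrt (tau1 + tau2)) z
    * expR (- (2 / (tau1 + tau2)) * X * Y)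
    * normal_pdf (tau1 * (z - 2 * Y) / (tau1 + tau2))
        (Num.sqrt (tau1 * tau2 / (tau1 + tau2))) x.
Proof.
move=> t1 t2 Y; apply: normal_pdf_complete_square => //; rewrite /Y.
field; rewrite !gt_eqF//; exact: addr_gt0.
Qed.

(** Now the starting point is reflected: sending [X] to [- X] displaces it by [- 2 * X], and the
    mean is that of the bridge from [- 2 * X] to [z] at time [tau1]. *)
Lemma h_pfh_future_step (R : realType) (tau1 tau2 X x z nu : R) :
  0 < tau1 -> 0 < tau2 ->
  normal_pdf 0 (Num.sqrt tau1) x * normal_pdf 0 (Num.sqrt tau2) (z - x)
    * expR (- (2 / tau1) * X * (X + x + nu * tau1)) =
  normal_pdf 0 (Num.sqrt (tau1 + tau2)) z
    * expR (- (2 / (tau1 + tau2)) * X * (X + z + nu * (tau1 + tau2)))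
    * normal_pdf ((z * tau1 - 2 * X * tau2) / (tau1 + tau2))
        (Num.sqrt (tau1 * tau2 / (tau1 + tau2))) x.
Proof.
move=> t1 t2; apply: normal_pdf_complete_square => //.
field; rewrite !gt_eqF//; exact: addr_gt0.
Qed.

(** This is the unweighted case: given the sum [z], the first increment has the law of an ordinary
    Brownian bridge. *)
Lemma normal_pdf_convolution_step (R : realType) (tau1 tau2 x z : R) :
  0 < tau1 -> 0 < tau2 ->
  normal_pdf 0 (Num.sqrt tau1) x * normal_pdf 0 (Num.sqrt tau2) (z - x) =
  normal_pdf 0 (Num.sqrt (tau1 + tau2)) z
    * normal_pdf (tau1 * z / (tau1 + tau2))
        (Num.sqrt (tau1 * tau2 / (tau1 + tau2))) x.
Proof.
move=> t1 t2.
have := @normal_pdf_complete_square R tau1 tau2 x z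
  (tau1 * z / (tau1 + tau2)) 0 0 t1 t2; rewrite expR0 !mulr1; apply.
field; rewrite !gt_eqF//; exact: addr_gt0.
Qed.

(** * Independence of one increment from the outer sigma-algebra *)

(** The independence of Brownian increments is stated along infinite strictly increasing sequences
    of times, so a finite set of times is sorted and then continued beyond its maximum. *)
Lemma increasing_enumeration (R : realDomainType) (s : seq R) :
  exists (t : nat -> R) (n : nat),
    [/\ forall i, t i < t i.+1, forall i, (i < n)%N -> t i \in s
      & forall x, x \in s -> exists2 i, (i < n)%N & t i = x].
Proof.
pose r := sort <=%R (undup s).
have memr x : (x \in r) = (x \in s) by rewrite mem_sort mem_undup.
have ltr : sorted <%R r by rewrite sort_lt_sorted undup_uniq.
(* The truncated subtraction vanishes for [i < size r]. From [i = size r] on, [nth] returns its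
   default [last 0 r], and the added integers 1, 2, ... keep the sequence strictly increasing. *)
exists (fun i => nth (last 0 r) r i + (i.+1 - size r)%:R), (size r); split.
- move=> i; have [ir|ir] := ltnP i.+1 (size r).
    rewrite (eqP (ltnW ir : _ == _)%N) (eqP (ir : _ == _)%N) !addr0.
    exact: (sortedP _ ltr).
  rewrite (@nth_default _ _ _ i.+1)//.
  have -> : nth (last 0 r) r i = last 0 r.
    have [ir'|?] := leqP (size r) i; first by rewrite nth_default.
    have -> : i = (size r).-1 by lia.
    by rewrite nth_last; case: (r).
  rewrite ltrD2l ltr_nat; lia.
- move=> i ir; rewrite (eqP (ir : _ == _)%N) addr0 -memr.
  exact: mem_nth.
- move=> x; rewrite -memr => xr; exists (index x r); first by rewrite index_mem.
  move: (xr); rewrite -index_mem => ir; rewrite (eqP (ir : _ == _)%N) addr0.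
  exact: nth_index.
Qed.

(** The maps sending [A] to [P (A]&[E)] and to [P A * P E] are finite measures that agree on the
    pi-system [G], hence on the sigma-algebra it generates. *)
Lemma indep_generated (d : measure_display) (T : measurableType d)
    (R : realType) (P : probability T R) (G : set_system T) (E : set T) :
  G `<=` measurable -> setI_closed G -> G setT -> measurable E ->
  (forall A, G A -> P (A `&` E) = (P A * P E)%E) ->
  forall A, <<s G >> A -> P (A `&` E) = (P A * P E)%E.
Proof.
move=> Gm GI GT mE GE A sA.
have PE0 : 0 <= fine (P E) by rewrite fine_ge0.
pose m1 : {measure set T -> \bar R} := mrestr P mE.
pose m2 : {measure set T -> \bar R} := mscale (NngNum PE0) P.
have PEE : (fine (P E))%:E = P E by rewrite fineK// fin_num_measure.
have m2E B : m2 B = (P B * P E)%E by rewrite /m2/= /mscale/= PEE muleC.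
rewrite -m2E -[LHS]/(m1 A).
apply: (g_sigma_algebra_measure_unique G Gm (fun=> setT)) => //.
- by rewrite bigcup_const.
- by move=> B GB; rewrite m2E; exact: GE.
- by move=> _; rewrite /m1/= /mrestr setTI ltey_eq fin_num_measure.
Qed.

Definition function_system (T : Type) (R : realType) (Phi : set (T -> R)) :
    set_system T :=
  \bigcup_(f in Phi) preimage_set_system setT f measurable.

Lemma function_system_measurable (T : pointedType) (R : realType)
    (Phi : set (T -> R)) (f : T -> R) :
  Phi f ->
  measurable_fun setT (f : g_sigma_algebraType (function_system Phi) -> R).
Proof.
move=> Phif _ A mA; apply: sub_sigma_algebra; exists f => //.
by exists A.
Qed.

Lemma sub_function_system (d : measure_display) (T : measurableType d)
    (R : realType) (Phi : set (T -> R)) (G : set_system T) :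
  (forall f, Phi f -> measurable_fun setT (f : g_sigma_algebraType G -> R)) ->
  <<s function_system Phi >> `<=` <<s G >>.
Proof.
move=> mPhi; apply: smallest_sub; first exact: smallest_sigma_algebra.
by move=> _ [f /mPhi mf [A mA <-]]; exact: mf.
Qed.

Lemma sub_measurable_function_system (d : measure_display)
    (T : measurableType d) (R : realType) (Phi : set (T -> R)) :
  (forall f, Phi f -> measurable_fun setT f) ->
  <<s function_system Phi >> `<=` measurable.
Proof.
move=> mPhi; apply: smallest_sub; first exact: sigma_algebra_measurable.
by move=> _ [f /mPhi mf [A mA <-]]; exact: mf.
Qed.

Lemma measure_preimage_ae_cst (d : measure_display) (T : measurableType d)
    (R : realType) (P : probability T R) (X : {RV P >-> R}) (c : R)
    (A : set R) (H : set T) :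
  {ae P, forall w, X w = c} -> measurable A -> measurable H ->
  P (X @^-1` A `&` H) = if c \in A then P H else 0%E.
Proof.
move=> [N [mN N0 XN]] mA mH.
have mXA : measurable (X @^-1` A) by exact: measurable_funPTI.
case: ifPn => [|]; rewrite ?inE ?notin_setE => cA.
  rewrite [RHS](measureDI P mH mXA) [X in (X + _)%E](_ : _ = 0%E).
    by rewrite add0e setIC.
  apply: (subset_measure0 _ _ _ N0) => //; first exact: measurableD.
  by move=> w [_ /= XwA]; apply: XN => /= Xw; apply: XwA; rewrite Xw.
apply: (subset_measure0 _ _ _ N0) => //; first exact: measurableI.
by move=> w [/= XwA _]; apply: XN => /= Xw; apply: cA; rewrite -Xw.
Qed.

Definition increment (d : measure_display) (T : measurableType d)
    (R : realType) (P : probability T R) (B : R -> {RV P >-> R}) (s t : R)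
    (w : T) : R := B t w - B s w.

Lemma measurable_increment (d : measure_display) (T : measurableType d)
    (R : realType) (P : probability T R) (B : R -> {RV P >-> R}) (s t : R) :
  measurable_fun setT (increment B s t).
Proof. exact: measurable_funB. Qed.

(* Under the hypotheses on Brownian motion B 0 vanishes only almost surely, so
   it does not disappear from the sigma-algebras below; it is carried along as
   an extra independent factor. *)
Definition increment_rectangle (d : measure_display) (T : measurableType d)
    (R : realType) (P : probability T R) (B : R -> {RV P >-> R})
    (t : nat -> R) (n : nat) (A0 : set R) (A : 'I_n -> set R) : set T :=
  B 0 @^-1` A0 `&`
  \bigcap_(i in [set: 'I_n]) increment B (t i) (t i.+1) @^-1` A i.

Lemma measurable_increment_rectangle (d : measure_display)
    (T : measurableType d) (R : realType) (P : probability T R)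
    (B : R -> {RV P >-> R}) (t : nat -> R) (n : nat) (A0 : set R)
    (A : 'I_n -> set R) :
  measurable A0 -> (forall i, measurable (A i)) ->
  measurable (increment_rectangle B t A0 A).
Proof.
move=> mA0 mA; apply: measurableI; first exact: measurable_funPTI.
apply: fin_bigcap_measurable => // i _.
by rewrite -[X in measurable X]setTI; exact: measurable_increment.
Qed.

Lemma increment_rectangleE (d : measure_display) (T : measurableType d)
    (R : realType) (P : probability T R) (B : R -> {RV P >-> R})
    (HB : standard_brownian_motion B) (t : nat -> R) (n : nat) (A0 : set R)
    (A : 'I_n -> set R) :
  0 <= t 0%N -> (forall i, t i < t i.+1) ->
  measurable A0 -> (forall i, measurable (A i)) ->
  P (increment_rectangle B t A0 A) =
  if 0 \in A0 then (\prod_(i < n) P (increment B (t i) (t i.+1) @^-1` A i))%E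
  else 0%E.
Proof.
move=> t0 tS mA0 mA.
rewrite (@measure_preimage_ae_cst _ _ _ _ (B 0) 0)//; last 2 first.
- exact: brownian_start HB.
- apply: fin_bigcap_measurable => // i _.
  by rewrite -[X in measurable X]setTI; exact: measurable_increment.
by rewrite (brownian_indep HB t0 tS mA).
Qed.

(** A pi-system for the sigma-algebra of [B 0] and of the first [n] increments other than the
    [k]-th, whose slot is left free. *)
Definition increment_rectangles (d : measure_display) (T : measurableType d)
    (R : realType) (P : probability T R) (B : R -> {RV P >-> R})
    (t : nat -> R) (n k : nat) : set_system T :=
  [set S | exists (A0 : set R) (A : 'I_n -> set R),
    [/\ measurable A0, forall i, measurable (A i),
        forall i : 'I_n, i = k :> nat -> A i = setT
      & S = increment_rectangle B t A0 A]].

(** Filling the free slot [k] with [C] gives again a rectangle, so the product formula splits off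
    exactly the factor of the [k]-th increment; the pi-system argument does the rest. *)
Lemma indep_increment_rectangles (d : measure_display) (T : measurableType d)
    (R : realType) (P : probability T R) (B : R -> {RV P >-> R})
    (HB : standard_brownian_motion B) (t : nat -> R) (n k : nat) (C : set R) :
  0 <= t 0%N -> (forall i, t i < t i.+1) -> (k < n)%N -> measurable C ->
  forall G, <<s increment_rectangles B t n k >> G ->
  P (G `&` increment B (t k) (t k.+1) @^-1` C) =
  (P G * P (increment B (t k) (t k.+1) @^-1` C))%E.
Proof.
move=> t0 tS kn mC; apply: indep_generated.
- move=> _ [A0 [A [mA0 mA _ ->]]].
  exact: measurable_increment_rectangle.
- move=> _ _ [A0 [A [mA0 mA Ak ->]]] [A0' [A' [mA0' mA' Ak' ->]]].
  exists (A0 `&` A0'), (fun i => A i `&` A' i); split => //.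
  + exact: measurableI.
  + by move=> i; exact: measurableI.
  + by move=> i ik; rewrite Ak// Ak'// setTI.
  + apply/seteqP; split => [w [[? Aw] [? Aw']]|w [[? ?] AAw]].
      by do 2 split => //; [exact: Aw|exact: Aw'].
    by split; split => // i iT; have [] := AAw i iT.
- exists setT, (fun=> setT); split => //.
  by apply/seteqP; split => w.
- by rewrite -[X in measurable X]setTI; exact: measurable_increment.
- move=> _ [A0 [A [mA0 mA Ak ->]]].
  pose K := Ordinal kn.
  pose A' i := if i == K then C else A i.
  have mA' i : measurable (A' i) by rewrite /A'; case: ifP.
  rewrite (_ : _ `&` _ = increment_rectangle B t A0 A'); last first.
    apply/seteqP; split => [w [[? Aw] Cw]|w [? Aw]]; split => //.
    - by move=> i iT; rewrite /A'; have [->//|_] := eqVneq i K; exact: Aw.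
    - split => // i iT; have := Aw i iT; rewrite /A'; case: eqVneq => // -> _.
      by rewrite Ak.
    - by have := Aw K I; rewrite /A' eqxx.
  rewrite !increment_rectangleE//; case: ifP => _; last by rewrite mul0e.
  rewrite (bigD1 K)//= [in RHS](bigD1 K)//= /A' eqxx Ak// preimage_setT.
  rewrite probability_setT mul1e muleC; congr (_ * _)%E.
  by apply: eq_bigr => i /negbTE ->.
Qed.

Lemma increment_rectangles_start_measurable (d : measure_display)
    (T : measurableType d) (R : realType) (P : probability T R)
    (B : R -> {RV P >-> R}) (t : nat -> R) (n k : nat) :
  measurable_fun setT
    (B 0 : g_sigma_algebraType (increment_rectangles B t n k) -> R).
Proof.
move=> _ A mA; rewrite setTI; apply: sub_sigma_algebra.
exists A, (fun=> setT); split => //.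
by apply/seteqP; split => [w Aw|w []//]; split.
Qed.

(** The increment telescopes into consecutive ones, and the condition on [k] keeps the [k]-th out of
    the sum. *)
Lemma increment_rectangles_measurable (d : measure_display)
    (T : measurableType d) (R : realType) (P : probability T R)
    (B : R -> {RV P >-> R}) (t : nat -> R) (n k i j : nat) :
  (i <= j)%N -> (j <= n)%N -> (j <= k)%N || (k < i)%N ->
  measurable_fun setT (increment B (t i) (t j)
    : g_sigma_algebraType (increment_rectangles B t n k) -> R).
Proof.
move=> ij jn kij; elim: j ij jn kij => [|j IH] ij jn kij.
  rewrite (_ : increment _ _ _ = cst 0); first exact: measurable_cst.
  apply/funext => w; rewrite /increment.
  by move: ij; rewrite leqn0 => /eqP ->; rewrite subrr.
have [->|ij'] := eqVneq i j.+1.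
  rewrite (_ : increment _ _ _ = cst 0); first exact: measurable_cst.
  by apply/funext => w; rewrite /increment subrr.
have -> : increment B (t i) (t j.+1) =
    (increment B (t j) (t j.+1) \+ increment B (t i) (t j)).
  by apply/funext => w; rewrite /increment/= addrA subrK.
apply: measurable_funD; last by apply: IH; lia.
move=> _ A mA; rewrite setTI; apply: sub_sigma_algebra.
exists setT, (fun l : 'I_n => if l == j :> nat then A else setT); split => //.
- by move=> l; case: ifP.
- by move=> l lk; case: eqVneq => // lj; lia.
- apply/seteqP; split => [w Aw|w [_ Aw]].
    by split => // l _; case: eqVneq => // ->.
  by have := Aw (Ordinal jn) I; rewrite eqxx.
Qed.

(* With D = setT, generates the sigma-algebra of the past of p and of the
   increments after q; a finite D gives the subfamilies that are controlled by
   finitely many increments. *)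
Definition outer_functions (d : measure_display) (T : measurableType d)
    (R : realType) (P : probability T R) (B : R -> {RV P >-> R})
    (D : set R) (p q : R) : set (T -> R) :=
  [set f : T -> R | (exists u, [/\ D u, 0 <= u, u <= p & f = B u]) \/
    (exists u v, [/\ D u, D v, q <= u, u <= v & f = increment B u v])].

(** Once [p] and [q] are consecutive times of an enumeration, every generator is a sum of [B 0] and
    increments, or of increments alone, none of them the one from [p] to [q]. *)
Lemma indep_outer_finite (d : measure_display) (T : measurableType d)
    (R : realType) (P : probability T R) (B : R -> {RV P >-> R})
    (HB : standard_brownian_motion B) (s : seq R) (p q : R) (C : set R) :
  0 <= p -> p < q -> measurable C ->
  forall G, <<s function_system (outer_functions B [set` s] p q) >> G ->
  P (G `&` increment B p q @^-1` C) =
  (P G * P (increment B p q @^-1` C))%E.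
Proof.
move=> p0 pq mC G sG.
(* Negative times and times strictly between [p] and [q] are dropped, as no generator involves them.
   The time 0 is added in order to write [B u] as [B 0] plus an increment. *)
pose s' := [:: 0, p, q & [seq x <- s | (0 <= x) && ((x <= p) || (q <= x))]].
have [t [n [tS ts' s't]]] := increasing_enumeration s'.
have tlt i j : (i < j)%N -> t i < t j by apply: homo_ltn lt_trans tS i j.
have tle i j : t i <= t j -> (i <= j)%N.
  move=> tij; rewrite leqNgt; apply/negP => /tlt.
  by rewrite ltNge tij.
have tltV i j : t i < t j -> (i < j)%N.
  move=> tij; rewrite ltnNge; apply/negP.
  rewrite leq_eqVlt => /orP[/eqP ji|/tlt ji].
    by move: tij; rewrite ji ltxx.
  by have := lt_trans ji tij; rewrite ltxx.
have [i0 i0n ti0] := s't 0 (mem_head _ _).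
have [k kn tk] : exists2 i, (i < n)%N & t i = p.
  by apply: s't; rewrite !inE eqxx orbT.
have [j jn tj] : exists2 i, (i < n)%N & t i = q.
  by apply: s't; rewrite !inE eqxx !orbT.
have s'P x : x \in s' -> (0 <= x) && ((x <= p) || (q <= x)).
  rewrite !inE => /or4P[/eqP->|/eqP->|/eqP->|].
  - by rewrite lexx p0.
  - by rewrite lexx p0.
  - by rewrite lexx orbT (le_trans p0 (ltW pq)).
  - by rewrite mem_filter => /andP[].
have t0 : 0 <= t 0%N.
  by have /s'P/andP[] : t 0%N \in s' by apply: ts'; lia.
(* A time between [p] and [q] would belong to [s'], which has none there; so [p] and [q] are
   consecutive. *)
have jk : j = k.+1.
  have kj : (k < j)%N by apply: tltV; rewrite tk tj.
  apply/eqP; rewrite eqn_leq kj andbT leqNgt; apply/negP => kj'.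
  have /s'P/andP[_ /orP[]] : t k.+1 \in s' by apply: ts'; lia.
  - by rewrite -tk leNgt tS.
  - by rewrite -tj leNgt tlt.
rewrite -tk -tj jk.
apply: (indep_increment_rectangles HB (n := n)) => //.
move: G sG; apply: sub_function_system => f.
move=> [[u [/= us u0 up ->]]|[u [v [/= us vs qu uv ->]]]].
  have [iu iun tiu] : exists2 i, (i < n)%N & t i = u.
    by apply: s't; rewrite !inE mem_filter us u0 up !orbT.
  have -> : (B u : T -> R) = (B 0 \+ increment B (t i0) (t iu)).
    by apply/funext => w; rewrite /increment/= tiu ti0 addrC subrK.
  apply: measurable_funD; first exact: increment_rectangles_start_measurable.
  apply: increment_rectangles_measurable.
  - by apply: tle; rewrite tiu ti0.
  - exact: ltnW.
  - by rewrite tle// tiu tk.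
have [iu iun tiu] : exists2 i, (i < n)%N & t i = u.
  apply: s't; rewrite !inE mem_filter us qu.
  by rewrite (le_trans p0 (le_trans (ltW pq) qu)) !orbT.
have [iv ivn tiv] : exists2 i, (i < n)%N & t i = v.
  apply: s't; rewrite !inE mem_filter vs (le_trans qu uv).
  by rewrite (le_trans p0 (le_trans (ltW pq) (le_trans qu uv))) !orbT.
rewrite -tiu -tiv; apply: increment_rectangles_measurable.
- by apply: tle; rewrite tiu tiv.
- exact: ltnW.
- by apply/orP; right; apply: tltV; rewrite tk tiu (lt_le_trans pq).
Qed.

Lemma outer_functions_measurable (d : measure_display) (T : measurableType d)
    (R : realType) (P : probability T R) (B : R -> {RV P >-> R})
    (D : set R) (p q : R) :
  <<s function_system (outer_functions B D p q) >> `<=` measurable.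
Proof.
apply: sub_measurable_function_system => f.
move=> [[u [_ _ _ ->]]|[u [v [_ _ _ _ ->]]]] //.
exact: measurable_increment.
Qed.

Lemma sub_outer_functions (d : measure_display) (T : measurableType d)
    (R : realType) (P : probability T R) (B : R -> {RV P >-> R})
    (D E : set R) (p q : R) : D `<=` E ->
  <<s function_system (outer_functions B D p q) >> `<=`
  <<s function_system (outer_functions B E p q) >>.
Proof.
move=> DE; apply: sub_function_system => f Df.
apply: function_system_measurable.
case: Df => [[u [Du u0 up ->]]|[u [v [Du Dv qu uv ->]]]]; [left|right].
  by exists u; split => //; exact: DE.
by exists u, v; split => //; exact: DE.
Qed.

(** The union [H] over finite sets of times is a pi-system, since two finite sets lie in a common
    one. It contains all generators, each of which involves at most two times. *)
Lemma indep_outer (d : measure_display) (T : measurableType d)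
    (R : realType) (P : probability T R) (B : R -> {RV P >-> R})
    (HB : standard_brownian_motion B) (p q : R) (C : set R) :
  0 <= p -> p < q -> measurable C ->
  forall G, <<s function_system (outer_functions B setT p q) >> G ->
  P (G `&` increment B p q @^-1` C) =
  (P G * P (increment B p q @^-1` C))%E.
Proof.
move=> p0 pq mC G sG.
pose H : set_system T := [set A | exists s : seq R,
  <<s function_system (outer_functions B [set` s] p q) >> A].
apply: (@indep_generated _ _ _ _ H).
- by move=> A [s]; exact: outer_functions_measurable.
- move=> A A' [s sA] [s' sA']; exists (s ++ s').
  have ss : [set` s] `<=` [set` s ++ s'] by move=> x /=; rewrite mem_cat => ->.
  have ss' : [set` s'] `<=` [set` s ++ s'].
    by move=> x /=; rewrite mem_cat => ->; rewrite orbT.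
  exact: (@measurableI _ (g_sigma_algebraType
    (function_system (outer_functions B [set` s ++ s'] p q))) _ _
    (sub_outer_functions ss sA) (sub_outer_functions ss' sA')).
- exists [::].
  exact: (@measurableT _ (g_sigma_algebraType
    (function_system (outer_functions B [set` [::]] p q)))).
- by rewrite -[X in measurable X]setTI; exact: measurable_increment.
- by move=> A [s]; exact: indep_outer_finite.
- move: G sG; apply: smallest_sub; first exact: smallest_sigma_algebra.
  move=> A [f outf Af]; apply: sub_sigma_algebra.
  case: outf => [[u [_ u0 up fE]]|[u [v [_ _ qu uv fE]]]].
    exists [:: u]; apply: sub_sigma_algebra; exists f => //.
    by left; exists u; split => //=; rewrite inE.
  exists [:: u; v]; apply: sub_sigma_algebra; exists f => //.
  by right; exists u, v; split => //=; rewrite !inE eqxx ?orbT.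
Qed.

(** * Freezing of independent variables and uniqueness of densities *)

(** The point [w], seen only through the smaller sigma-algebra, is itself a random element whose law
    is the restriction of [P]. Independence makes its joint law with [Y] the product of this
    restriction and [lambda], and Tonelli gives the iterated integral. *)
Lemma integral_indep_freeze (d : measure_display) (T : measurableType d)
    (R : realType) (P : probability T R) (G : set_system T) (Y : T -> R)
    (lambda : probability (measurableTypeR R) R)
    (F : g_sigma_algebraType G * measurableTypeR R -> \bar R) :
  <<s G >> `<=` measurable -> measurable_fun setT Y ->
  (forall A C, <<s G >> A -> measurable C ->
    P (A `&` Y @^-1` C) = (P A * lambda C)%E) ->
  measurable_fun setT F -> (forall z, 0 <= F z)%E ->
  (\int[P]_w F (w, Y w) = \int[P]_w \int[lambda]_y F (w, y))%E.
Proof.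
move=> sG mY indep mF F0.
have mid : measurable_fun setT (idfun : T -> g_sigma_algebraType G).
  by move=> _ A mA; rewrite setTI; exact: sG.
pose phi w : g_sigma_algebraType G * measurableTypeR R := (w, Y w).
have mphi : measurable_fun setT phi by exact: measurable_fun_pair.
pose i : {mfun T >-> g_sigma_algebraType G} := mfun_Sub (mem_set mid).
pose j : {mfun T >-> (g_sigma_algebraType G * measurableTypeR R)%type} :=
  mfun_Sub (mem_set mphi).
have lawE A : measurable A ->
    (distribution P i \x lambda)%E A = distribution P j A.
  apply: product_measure_unique => A1 A2 mA1 mA2.
  exact: indep.
transitivity (\int[distribution P j]_z F z)%E.
  by rewrite ge0_integral_distribution.
rewrite -(@eq_measure_integral _ _ _ _ _
  (distribution P i \x lambda)%E); last first.
  by move=> A mA _; exact: lawE.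
rewrite (fubini_tonelli1 _ mF F0).
rewrite ge0_integral_distribution//.
- exact: measurable_fun_fubini_tonelli_F.
- by move=> w; exact: integral_ge0.
Qed.

Lemma density_measure (d : measure_display) (T : measurableType d)
    (R : realType) (mu : {measure set T -> \bar R}) (f : T -> \bar R) :
  measurable_fun setT f -> (forall w, 0 <= f w)%E ->
  exists nu : {measure set T -> \bar R},
    forall A, nu A = (\int[mu]_(w in A) f w)%E.
Proof.
move=> mf f0; pose nu (A : set T) := (\int[mu]_(w in A) f w)%E.
have nu0 : nu set0 = 0%E by rewrite /nu integral_set0.
have nu_ge0 A : (0 <= nu A)%E by apply: integral_ge0 => w _.
have nu_add : semi_sigma_additive nu.
  move=> F mF tF mUF; rewrite /nu ge0_integral_bigcup//.
    by apply: is_cvg_ereal_nneg_natsum_cond => n _ _; exact: nu_ge0.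
  exact: measurable_funTS.
pose nu_mix := isMeasure.Build _ _ _ nu nu0 nu_ge0 nu_add.
pose nuM : {measure set T -> \bar R} := HB.pack nu nu_mix.
by exists nuM.
Qed.

(** Uniqueness of measures on a pi-system, applied to the measures with densities [f] and [g]. The
    sets [E n] provide sigma-finiteness, so neither function has to be integrable over the whole
    space. *)
Lemma eq_integral_generated (d : measure_display) (T : measurableType d)
    (R : realType) (mu : {measure set T -> \bar R}) (G : set_system T)
    (E : (set T)^nat) (f g : T -> \bar R) :
  G `<=` measurable -> setI_closed G -> (forall n, G (E n)) ->
  \bigcup_n E n = setT ->
  measurable_fun setT f -> (forall w, 0 <= f w)%E ->
  measurable_fun setT g -> (forall w, 0 <= g w)%E ->
  (forall A, G A -> \int[mu]_(w in A) f w = \int[mu]_(w in A) g w)%E ->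
  (forall n, \int[mu]_(w in E n) g w < +oo)%E ->
  forall A, <<s G >> A -> (\int[mu]_(w in A) f w = \int[mu]_(w in A) g w)%E.
Proof.
move=> Gm GI GE Ecover mf f0 mg g0 fg gfin A sA.
have [nf nfE] := density_measure mu mf f0.
have [ng ngE] := density_measure mu mg g0.
rewrite -nfE -ngE; apply: (g_sigma_algebra_measure_unique G Gm E) => //.
  by move=> C GC; rewrite nfE ngE fg.
by move=> n; rewrite nfE fg.
Qed.

Lemma sub_outer_functions_itv (d : measure_display) (T : measurableType d)
    (R : realType) (P : probability T R) (B : R -> {RV P >-> R})
    (D : set R) (p p' q q' : R) : p <= p' -> q' <= q ->
  <<s function_system (outer_functions B D p q) >> `<=`
  <<s function_system (outer_functions B D p' q') >>.
Proof.
move=> pp' q'q; apply: sub_function_system => f Df.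
apply: function_system_measurable.
case: Df => [[u [Du u0 up ->]]|[u [v [Du Dv qu uv ->]]]]; [left|right].
  by exists u; split => //; exact: le_trans pp'.
by exists u, v; split => //; exact: le_trans qu.
Qed.

Lemma measurable_indic_kernel (d : measure_display) (T : measurableType d)
    (R : realType) (S : T -> R) (G : set T) (C : set R)
    (k : R -> R -> R -> R) :
  measurable_fun setT (fun y : R * R * R => k y.1.1 y.1.2 y.2) ->
  measurable G -> measurable C -> measurable_fun setT S ->
  measurable_fun setT (fun y : T * measurableTypeR R * measurableTypeR R =>
    (\1_G y.1.1 * \1_C (y.1.2 + y.2) * k (S y.1.1) y.1.2 (y.1.2 + y.2))%:E).
Proof.
move=> mk mG mC mS; apply/measurable_EFinP.
have m11 : measurable_fun setT
    (fun y : T * measurableTypeR R * measurableTypeR R => y.1.1).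
  exact: (measurableT_comp measurable_fst measurable_fst).
have m12 : measurable_fun setT
    (fun y : T * measurableTypeR R * measurableTypeR R => y.1.2 : R).
  exact: (measurableT_comp measurable_snd measurable_fst).
have m2 : measurable_fun setT
    (fun y : T * measurableTypeR R * measurableTypeR R => y.2 : R).
  exact: measurable_snd.
have ms : measurable_fun setT
    (fun y : T * measurableTypeR R * measurableTypeR R => y.1.2 + y.2 : R).
  exact: measurable_funD.
apply: measurable_funM; first apply: measurable_funM.
- by apply: (measurableT_comp (f := \1_G : T -> R)).
- by apply: (measurableT_comp (f := \1_C : R -> R)).
- apply: (measurableT_comp (f := fun y : R * R * R => k y.1.1 y.1.2 y.2)
    (g := fun y : T * measurableTypeR R * measurableTypeR R =>
      (S y.1.1, y.1.2, y.1.2 + y.2))) => //.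
  apply: measurable_fun_pair => //; apply: measurable_fun_pair => //.
  exact: measurableT_comp.
Qed.

(** * Integrals over the events of the past-future sigma-algebra *)

Lemma indep_outer_normal (d : measure_display) (T : measurableType d)
    (R : realType) (P : probability T R) (B : R -> {RV P >-> R})
    (HB : standard_brownian_motion B) (p q : R) :
  0 <= p -> p < q -> forall (G : set T) (C : set R),
  <<s function_system (outer_functions B setT p q) >> G -> measurable C ->
  P (G `&` increment B p q @^-1` C) =
  (P G * normal_prob 0 (Num.sqrt (q - p)) C)%E.
Proof.
move=> p0 pq G C sG mC; rewrite (indep_outer HB p0 pq mC sG).
by congr (_ * _)%E; rewrite -(brownian_normal HB p0 pq mC).
Qed.

(** The increments over [[q, r]] and then over [[p, q]] are integrated out against their normal laws
    with the rest frozen; the double integral that remains is the convolution computed above. *)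
Lemma integral_outer_rectangle (d : measure_display) (T : measurableType d)
    (R : realType) (P : probability T R) (B : R -> {RV P >-> R})
    (HB : standard_brownian_motion B) (p q r s : R) (G : set T) (C : set R)
    (k : R -> R -> R -> R) (c m : R -> R -> R) :
  0 <= p -> p < q -> q < r ->
  <<s function_system (outer_functions B setT p r) >> G -> measurable C ->
  measurable_fun setT (fun y : R * R * R => k y.1.1 y.1.2 y.2) ->
  (forall x a z, 0 <= k x a z) -> (forall x z, 0 <= c x z) ->
  (forall x a z, normal_pdf 0 (Num.sqrt (q - p)) a
    * normal_pdf 0 (Num.sqrt (r - q)) (z - a) * k x a z =
    c x z * normal_pdf (m x z) s a) ->
  (\int[P]_(w in G `&` increment B p r @^-1` C)
    (k (B p w) (increment B p q w) (increment B p r w))%:E =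
  \int[P]_w \int[lebesgue_measure]_z (\1_G w * \1_C z * c (B p w) z)%:E)%E.
Proof.
move=> p0 pq qr sG mC mk k0 c0 kc.
have q0 : 0 <= q by rewrite (le_trans p0)// ltW.
have incrE w : increment B p r w = increment B p q w + increment B q r w.
  by rewrite /increment; ring.
(* Both sigma-algebras contain [G] and make [B p] measurable. The past of [q] being part of [Gqr],
   the increment from [p] to [q] is measurable there and can be frozen first. *)
pose Gpq := function_system (outer_functions B setT p q).
pose Gqr := function_system (outer_functions B setT q r).
have sGpq : <<s Gpq >> G by apply: sub_outer_functions_itv (ltW qr) _ sG.
have sGqr : <<s Gqr >> G by apply: sub_outer_functions_itv (ltW pq) _ _ sG.
pose Phi w x y := \1_G w * \1_C (x + y) * k (B p w) x (x + y).
have Phi0 w x y : 0 <= Phi w x y by rewrite /Phi !mulr_ge0.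
have mBpq : measurable_fun setT (B p : g_sigma_algebraType Gpq -> R).
  by apply: function_system_measurable; left; exists p.
have mBqr u : 0 <= u -> u <= q ->
    measurable_fun setT (B u : g_sigma_algebraType Gqr -> R).
  by move=> u0 uq; apply: function_system_measurable; left; exists u.
transitivity (\int[P]_w
    (Phi w (increment B p q w) (increment B q r w))%:E)%E.
  rewrite integral_mkcond; apply: eq_integral => w _.
  have [[Gw Cw]|GCw] := pselect ((G `&` increment B p r @^-1` C) w).
    rewrite patchE mem_set// /Phi -incrE !indicE mem_set// mem_set//.
    by rewrite !mul1r.
  rewrite patchE memNset// /Phi -incrE !indicE.
  have [wG|] := boolP (w \in G); last by rewrite !mul0r.
  have [wC|] := boolP (_ \in C); last by rewrite mulr0 mul0r.
  by exfalso; apply: GCw; split; apply: set_mem.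
have mPhiqr : measurable_fun setT
    (fun y : g_sigma_algebraType Gqr * measurableTypeR R =>
    (Phi y.1 (increment B p q y.1) y.2)%:E).
  have mi : measurable_fun setT
      (increment B p q : g_sigma_algebraType Gqr -> R).
    by apply: measurable_funB; apply: mBqr => //; exact: ltW.
  have mK := @measurable_indic_kernel _ (g_sigma_algebraType Gqr) R (B p) G C k
    mk sGqr mC (mBqr p p0 (ltW pq)).
  apply: (measurableT_comp mK
    (g := fun y : g_sigma_algebraType Gqr * measurableTypeR R =>
    (y.1, increment B p q y.1 : measurableTypeR R, y.2))).
  apply: measurable_fun_pair => //; apply: measurable_fun_pair => //.
  exact: measurableT_comp.
have mPhipq : measurable_fun setT
    (fun y : g_sigma_algebraType Gpq * measurableTypeR R =>
      \int[normal_prob 0 (Num.sqrt (r - q))]_b (Phi y.1 y.2 b)%:E)%E.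
  have mK := @measurable_indic_kernel _ (g_sigma_algebraType Gpq) R (B p) G C k
    mk sGpq mC mBpq.
  have := @measurable_fun_fubini_tonelli_F _ _
    (g_sigma_algebraType Gpq * measurableTypeR R)%type (measurableTypeR R) R
    (normal_prob 0 (Num.sqrt (r - q))) _ mK.
  by apply => y; rewrite lee_fin; exact: Phi0.
rewrite (integral_indep_freeze (P := P) (G := Gqr) (Y := increment B q r)
  (lambda := normal_prob 0 (Num.sqrt (r - q)))
  (F := fun y => (Phi y.1 (increment B p q y.1) y.2)%:E)) => //=; first last.
- by move=> y; rewrite lee_fin; exact: Phi0.
- by move=> A C' sA mC'; exact: indep_outer_normal.
- exact: measurable_increment.
- exact: outer_functions_measurable.
(* The inner integral depends on [w] only through [G], [B p] and the increment from [p] to [q], so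
   the latter can now be integrated out too. *)
rewrite (integral_indep_freeze (P := P) (G := Gpq) (Y := increment B p q)
  (lambda := normal_prob 0 (Num.sqrt (q - p)))
  (F := fun y => \int[normal_prob 0 (Num.sqrt (r - q))]_b (Phi y.1 y.2 b)%:E)%E)
  => //=; first last.
- by move=> y; apply: integral_ge0 => b _; rewrite lee_fin.
- by move=> A C' sA mC'; exact: indep_outer_normal.
- exact: measurable_increment.
- exact: outer_functions_measurable.
apply: eq_integral => w _.
apply: (@integral_normal_convolution _ _ _ s (m (B p w)) _
  (fun a z => \1_G w * \1_C z * k (B p w) a z)).
- apply: measurable_funM; first apply: measurable_funM => //.
    by apply: (measurableT_comp (f := \1_C : R -> R)).
  apply: (measurableT_comp (f := fun y : R * R * R => k y.1.1 y.1.2 y.2)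
    (g := fun y : R * R => (B p w, y.1, y.2))) => //.
  by apply: measurable_fun_pair => //; apply: measurable_fun_pair.
- by move=> x z; rewrite !mulr_ge0.
- by move=> z; rewrite !mulr_ge0.
- by move=> x z; rewrite mulrCA kc; ring.
Qed.

Definition outer_rectangles (d : measure_display) (T : measurableType d)
    (R : realType) (P : probability T R) (B : R -> {RV P >-> R}) (p r : R)
    : set_system T :=
  [set A | exists G C,
    [/\ <<s function_system (outer_functions B setT p r) >> G, measurable C
      & A = G `&` increment B p r @^-1` C]].

(** A future value [B u] is the sum of [B p], the increment over [[p, r]] and an increment after
    [r]; the rectangles control the middle term through [C] and the others through [G]. *)
Lemma past_future_sub_outer_rectangles (d : measure_display)
    (T : measurableType d) (R : realType) (P : probability T R)
    (B : R -> {RV P >-> R}) (p r : R) : 0 <= p -> p <= r ->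
  past_future B p r `<=` <<s outer_rectangles B p r >>.
Proof.
move=> p0 pr.
have outerE f : outer_functions B setT p r f ->
    measurable_fun setT (f : g_sigma_algebraType (outer_rectangles B p r) -> R).
  move=> outf _ A mA; rewrite setTI; apply: sub_sigma_algebra.
  exists (f @^-1` A), setT; split => //; last by rewrite preimage_setT setIT.
  rewrite -[X in _ X]setTI.
  exact: (function_system_measurable outf measurableT mA).
have mincr : measurable_fun setT
    (increment B p r : g_sigma_algebraType (outer_rectangles B p r) -> R).
  move=> _ A mA; rewrite setTI; apply: sub_sigma_algebra.
  exists setT, A; split => //; last by rewrite setTI.
  exact: (@measurableT _ (g_sigma_algebraType
    (function_system (outer_functions B setT p r)))).
apply: smallest_sub; first exact: smallest_sigma_algebra.
move=> _ [u /= up [A mA <-]].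
suff mBu : measurable_fun setT
    (B u : g_sigma_algebraType (outer_rectangles B p r) -> R) by exact: mBu.
case: up => [/andP[u0 up]|ru].
  by apply: outerE; left; exists u.
have -> : (B u : T -> R) = (B p \+ increment B p r \+ increment B r u).
  by apply/funext => w; rewrite /increment/=; ring.
apply: measurable_funD; first apply: measurable_funD => //.
  by apply: outerE; left; exists p.
by apply: outerE; right; exists r, u.
Qed.

(** Over an outer rectangle, [k] and [g] give the same double integral: in both cases the first
    increment, for a fixed total [z], integrates out to the factor [c]. The rectangles form a
    pi-system, which extends the equality to the whole past-future sigma-algebra. *)
Lemma integral_past_future_step (d : measure_display) (T : measurableType d)
    (R : realType) (P : probability T R) (B : R -> {RV P >-> R})
    (HB : standard_brownian_motion B) (p q r s : R)
    (k : R -> R -> R -> R) (g m : R -> R -> R) :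
  0 <= p -> p < q -> q < r ->
  measurable_fun setT (fun y : R * R * R => k y.1.1 y.1.2 y.2) ->
  (forall x a z, 0 <= k x a z) ->
  measurable_fun setT (fun y : R * R => g y.1 y.2) ->
  (forall x z, 0 <= g x z) ->
  (forall n : nat, exists M, forall x z,
    `|x| <= n%:R -> `|z| <= n%:R -> g x z <= M) ->
  (forall x a z, normal_pdf 0 (Num.sqrt (q - p)) a
    * normal_pdf 0 (Num.sqrt (r - q)) (z - a) * k x a z =
    normal_pdf 0 (Num.sqrt (q - p + (r - q))) z * g x z
    * normal_pdf (m x z) s a) ->
  forall A, past_future B p r A ->
  (\int[P]_(w in A) (k (B p w) (increment B p q w) (increment B p r w))%:E =
   \int[P]_(w in A) (g (B p w) (increment B p r w))%:E)%E.
Proof.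
move=> p0 pq qr mk k0 mg g0 gM kg A sA.
have pr : p < r by exact: lt_trans qr.
have mincr u v : measurable_fun setT (increment B u v).
  exact: measurable_increment.
have outmeas := @outer_functions_measurable _ _ _ _ B setT p r.
have mgw : measurable_fun setT (fun w => g (B p w) (increment B p r w)).
  apply: (measurableT_comp (f := fun y : R * R => g y.1 y.2)
    (g := fun w => (B p w, increment B p r w))) => //.
  exact: measurable_fun_pair.
(* On these events [B p] and the total increment are bounded by [n], so [gM] makes the integral of
   [g] finite. *)
pose E (n : nat) : set T := B p @^-1` `[- n%:R, n%:R] `&`
  increment B p r @^-1` `[- n%:R, n%:R].
apply: (eq_integral_generated (G := outer_rectangles B p r) (E := E)) => //.
- move=> _ [G [C [sG mC ->]]]; apply: measurableI; first exact: outmeas.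
  by rewrite -[X in measurable X]setTI; exact: mincr.
- move=> _ _ [G [C [sG mC ->]]] [G' [C' [sG' mC' ->]]].
  exists (G `&` G'), (C `&` C'); split; last by rewrite preimage_setI setIACA.
    exact: (@measurableI _ (g_sigma_algebraType
      (function_system (outer_functions B setT p r))) _ _ sG sG').
  exact: measurableI.
- move=> n; exists (B p @^-1` `[- n%:R, n%:R]), `[- n%:R, n%:R]%classic.
  split => //; rewrite -[X in _ X]setTI.
  apply: (@function_system_measurable _ _ (outer_functions B setT p r)
    (B p)) => //.
  by left; exists p.
- rewrite -subTset => w _.
  have [n nw] : exists n : nat, Num.max `|B p w| `|increment B p r w| <= n%:R.
    exists (Num.trunc (Num.max `|B p w| `|increment B p r w|)).+1.
    by rewrite ltW// truncnS_gt.
  exists n => //; move: nw; rewrite ge_max => /andP[nB ni].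
  by split => /=; rewrite in_itv/= -ler_norml.
- apply/measurable_EFinP.
  apply: (measurableT_comp (f := fun y : R * R * R => k y.1.1 y.1.2 y.2)
    (g := fun w => (B p w, increment B p q w, increment B p r w))) => //.
  by apply: measurable_fun_pair => //; exact: measurable_fun_pair.
- by move=> w; rewrite lee_fin.
- exact/measurable_EFinP.
- by move=> w; rewrite lee_fin.
- move=> _ [G [C [sG mC ->]]].
  pose c x z := normal_pdf 0 (Num.sqrt (q - p + (r - q))) z * g x z.
  have c0 x z : 0 <= c x z by rewrite mulr_ge0// normal_pdf_ge0.
  rewrite (integral_outer_rectangle HB (c := c) (m := m) (s := s) (q := q))//.
  (* As [g] does not depend on the intermediate increment, the ordinary bridge density integrates
     out and leaves the same [c]. *)
  rewrite (@integral_outer_rectangle _ _ _ _ _ HB p q r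
    (Num.sqrt ((q - p) * (r - q) / (q - p + (r - q)))) G C
    (fun x _ z => g x z) c (fun _ z => (q - p) * z / (q - p + (r - q))))//.
    apply: (measurableT_comp (f := fun y : R * R => g y.1 y.2)
      (g := fun y : R * R * R => (y.1.1, y.2))) => //.
    apply: measurable_fun_pair => //.
    exact: (measurableT_comp measurable_fst measurable_fst).
  move=> x a z; rewrite normal_pdf_convolution_step ?subr_gt0// /c.
  by ring.
- move=> n; have [M gMn] := gM n.
  have mE : measurable (E n).
    by apply: measurableI; rewrite -[X in measurable X]setTI;
      [exact: measurable_funPT|exact: mincr].
  apply: (@le_lt_trans _ _ (\int[P]_(w in E n) (Num.max M 0)%:E)%E).
    apply: ge0_le_integral => //.
    - by move=> w _; rewrite lee_fin.
    - by apply/measurable_EFinP; exact: measurable_funTS.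
    - move=> w [/= Bn In]; rewrite lee_fin le_max gMn//;
      by move: Bn In; rewrite !in_itv/= -!ler_norml.
  rewrite integral_cst// lte_mul_pinfty ?lee_fin ?le_max ?lexx ?orbT//.
  by rewrite ltey_eq fin_num_measure.
- exact: past_future_sub_outer_rectangles (ltW pr) _ sA.
Qed.

(** * The functions [h_pfh] and their harmonicity *)

Lemma h_pfh_ge0 (R : realType) (l nu s t x y : R) : 0 <= h_pfh l nu s t x y.
Proof. exact: expR_ge0. Qed.

Lemma measurable_h_pfh (d : measure_display) (T : measurableType d)
    (R : realType) (l nu s t : R) (u v : T -> R) :
  measurable_fun setT u -> measurable_fun setT v ->
  measurable_fun setT (fun w => h_pfh l nu s t (u w) (v w)).
Proof.
move=> mu mv; apply: measurableT_comp => //; apply: measurable_funM.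
  apply: measurable_funM => //; apply: measurable_funB => //.
  exact: measurable_funD.
apply: measurable_funB => //; exact: measurable_funD.
Qed.

Lemma h_pfh_bounded (R : realType) (l nu s t : R) (n : nat) : s < t ->
  exists M, forall x z, `|x| <= n%:R -> `|z| <= n%:R ->
    h_pfh l nu s t x (x + z) <= M.
Proof.
move=> st; pose a := n%:R + `|nu * s - l|.
pose b := n%:R + n%:R + `|nu * t - l|.
pose c := 2 / (t - s).
have c0 : 0 <= c by rewrite divr_ge0// subr_ge0 ltW.
exists (expR (c * (a * b))) => x z xn zn; rewrite /h_pfh -/c ler_expR.
apply: le_trans (ler_norm _) _.
rewrite -mulrA !normrM normrN (ger0_norm c0) ler_wpM2l//.
have ha : `|x + nu * s - l| <= a.
  by rewrite -addrA (le_trans (ler_normD _ _))// lerD2r.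
have hb : `|x + z + nu * t - l| <= b.
  rewrite -addrA (le_trans (ler_normD _ _))// lerD2r.
  by rewrite (le_trans (ler_normD _ _))// lerD.
exact: ler_pM.
Qed.

(** The general step with [p = s'], [q = s], [r = t]: the left end point moves, and [k] depends on
    both the first increment and the total one. *)
Lemma integral_h_pfh_past (d : measure_display) (T : measurableType d)
    (R : realType) (P : probability T R) (B : R -> {RV P >-> R})
    (HB : standard_brownian_motion B) (l nu s' s t : R) (A : set T) :
  0 <= s' -> s' <= s -> s < t -> past_future B s' t A ->
  (\int[P]_(w in A) (h_pfh l nu s t (B s w) (B t w))%:E =
   \int[P]_(w in A) (h_pfh l nu s' t (B s' w) (B t w))%:E)%E.
Proof.
move=> s'0; rewrite le_eqVlt => /orP[/eqP ->//|s's st sA].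
have incrE u v w : B u w + increment B u v w = B v w.
  by rewrite /increment; ring.
have t1 : 0 < s - s' by rewrite subr_gt0.
have t2 : 0 < t - s by rewrite subr_gt0.
have mfst : measurable_fun setT (fun y : R * R * R => y.1.1).
  exact: (measurableT_comp measurable_fst measurable_fst).
have mmid : measurable_fun setT (fun y : R * R * R => y.1.2).
  exact: (measurableT_comp measurable_snd measurable_fst).
have := @integral_past_future_step _ _ _ _ _ HB s' s t
  (Num.sqrt ((s - s') * (t - s) / (s - s' + (t - s))))
  (fun x a z => h_pfh l nu s t (x + a) (x + z))
  (fun x z => h_pfh l nu s' t x (x + z))
  (fun x z => (s - s') * (z - 2 * (x + z + nu * t - l)) / (s - s' + (t - s)))
  s'0 s's st.
under [in X in _ -> X]eq_integral do rewrite -(incrE s' s) -(incrE s' t).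
under [in X in _ -> _ = X]eq_integral do rewrite -(incrE s' t).
apply => //.
- by apply: measurable_h_pfh; exact: measurable_funD.
- by move=> *; exact: h_pfh_ge0.
- by apply: measurable_h_pfh => //; exact: measurable_funD.
- by move=> *; exact: h_pfh_ge0.
- by move=> n; apply: h_pfh_bounded; exact: lt_trans st.
move=> x a z.
(* With this choice of [X], the drift over [t - s'] turns [Y] into [x + z + nu * t - l], the second
   factor of [h_pfh]. *)
have := h_pfh_past_step (x + nu * s' - l) a z nu t1 t2.
rewrite /= /h_pfh.
have -> : x + nu * s' - l + z + nu * (s - s' + (t - s)) = x + z + nu * t - l.
  by ring.
have -> : x + nu * s' - l + a + nu * (s - s') = x + a + nu * s - l by ring.
by rewrite (_ : t - s' = s - s' + (t - s)) //; ring.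
Qed.

(** The general step with [p = s], [q = t], [r = t']: the right end point moves, and [k] involves
    the first increment only. *)
Lemma integral_h_pfh_future (d : measure_display) (T : measurableType d)
    (R : realType) (P : probability T R) (B : R -> {RV P >-> R})
    (HB : standard_brownian_motion B) (l nu s t t' : R) (A : set T) :
  0 <= s -> s < t -> t <= t' -> past_future B s t' A ->
  (\int[P]_(w in A) (h_pfh l nu s t (B s w) (B t w))%:E =
   \int[P]_(w in A) (h_pfh l nu s t' (B s w) (B t' w))%:E)%E.
Proof.
move=> s0 st; rewrite le_eqVlt => /orP[/eqP ->//|tt' sA].
have incrE u v w : B u w + increment B u v w = B v w.
  by rewrite /increment; ring.
have t1 : 0 < t - s by rewrite subr_gt0.
have t2 : 0 < t' - t by rewrite subr_gt0.
have mfst : measurable_fun setT (fun y : R * R * R => y.1.1).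
  exact: (measurableT_comp measurable_fst measurable_fst).
have mmid : measurable_fun setT (fun y : R * R * R => y.1.2).
  exact: (measurableT_comp measurable_snd measurable_fst).
have := @integral_past_future_step _ _ _ _ _ HB s t t'
  (Num.sqrt ((t - s) * (t' - t) / (t - s + (t' - t))))
  (fun x a _ => h_pfh l nu s t x (x + a))
  (fun x z => h_pfh l nu s t' x (x + z))
  (fun x z => (z * (t - s) - 2 * (x + nu * s - l) * (t' - t))
    / (t - s + (t' - t)))
  s0 st tt'.
under [in X in _ -> X]eq_integral do rewrite -(incrE s t).
under [in X in _ -> _ = X]eq_integral do rewrite -(incrE s t').
apply => //.
- by apply: measurable_h_pfh => //; exact: measurable_funD.
- by move=> *; exact: h_pfh_ge0.
- by apply: measurable_h_pfh => //; exact: measurable_funD.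
- by move=> *; exact: h_pfh_ge0.
- by move=> n; apply: h_pfh_bounded; exact: lt_trans tt'.
move=> x a z.
have := h_pfh_future_step (x + nu * s - l) a z nu t1 t2.
rewrite /= /h_pfh.
have -> : x + nu * s - l + z + nu * (t - s + (t' - t)) = x + z + nu * t' - l.
  by ring.
have -> : x + nu * s - l + a + nu * (t - s) = x + a + nu * t - l by ring.
by rewrite (_ : t' - s = t - s + (t' - t)) //; ring.
Qed.

Lemma past_future_function_system (d : measure_display)
    (T : measurableType d) (R : realType) (P : probability T R)
    (B : R -> {RV P >-> R}) (s t u : R) : 0 <= u <= s \/ t <= u ->
  measurable_fun setT (B u : g_sigma_algebraType
    (\bigcup_(u in [set u : R | 0 <= u <= s \/ t <= u])
        preimage_set_system setT (B u) measurable) -> R).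
Proof.
by move=> su _ A mA; apply: sub_sigma_algebra; exists u => //; exists A.
Qed.

Lemma sub_past_future (d : measure_display)
    (T : measurableType d) (R : realType) (P : probability T R)
    (B : R -> {RV P >-> R}) (s s' t t' : R) : s' <= s -> t <= t' ->
  past_future B s' t' `<=` past_future B s t.
Proof.
move=> s's tt'; apply: sub_sigma_algebra2; apply: bigcup_subset => u /=.
move=> [/andP[-> us']|t'u]; first by left; exact: le_trans s's.
by right; exact: le_trans t'u.
Qed.

Theorem theorem6p2 (d : measure_display) (T : measurableType d)
    (R : realType) (P : probability T R) (B : R -> {RV P >-> R})
    (HB : standard_brownian_motion B) (l nu : R) :
  past_future_harmonic B (h_pfh l nu).
Proof.
have mh s t : 0 < s -> s < t ->
    measurable_fun setT ((fun w => h_pfh l nu s t (B s w) (B t w))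
      : g_sigma_algebraType
        (\bigcup_(u in [set u : R | 0 <= u <= s \/ t <= u])
          preimage_set_system setT (B u) measurable) -> R).
  move=> s0 st; apply: measurable_h_pfh; apply: past_future_function_system.
    by left; rewrite lexx ltW.
  by right.
split; first by move=> s t x y _ _; exact: h_pfh_ge0.
split.
- by move=> s t _ _ w; exact: h_pfh_ge0.
- by move=> s t s0 st A mA; rewrite -[X in _ X]setTI; exact: mh.
move=> s' s t t' s'0 s's st tt'.
have s't' : s' < t' by rewrite (le_lt_trans s's)// (lt_le_trans st).
split.
- move=> A mA; rewrite -[X in _ X]setTI.
  have /measurable_EFinP := mh _ _ s'0 s't'.
  by move=> /(_ measurableT A mA).
- by move=> w; rewrite lee_fin h_pfh_ge0.
- move=> A sA.
  (* The two moves meet at the pair [(s', t)]. The event [A] suits both, since it also belongs to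
     the larger sigma-algebra [past_future B s' t]. *)
  rewrite /= -(integral_h_pfh_future HB l nu (ltW s'0)
    (le_lt_trans s's st) tt' sA).
  apply/esym/(integral_h_pfh_past HB l nu (ltW s'0) s's st).
  exact: sub_past_future sA.
Qed.
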